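(* Let $r\ge 4$ be fixed. There exist $C>0$ and $n_0$ such that for every $n\ge n_0$ and every intersecting $n$-vertex $r$-graph $H$ with $|H|>|FP(n,r)|$, one can delete from $H$ at most $Cn^{r-4}$ edges so that the resulting $r$-graph $H'$ is contained in one of $H^r_0(n),\ldots,H^r_5(n)$, $EM(n,r,1)$.
   Context: An $r$-graph is a family of $r$-element subsets (edges) of a finite vertex set; intersecting means every two edges intersect. ''$H'$ is contained in $K$'' means the special vertices of $K$ can be chosen among the vertices of $H$ so that every edge of $H'$ is an edge of $K$. $EM(n,r,1)$ is the full star: all $r$-subsets of an $n$-set containing a fixed vertex. $FP(n,r)$: on vertex set $[n]$, fix $X=\{x\}\cup Y\cup Z$ with $|X|=2r$, $|Y|=r$, $|Z|=r-1$, and $Y_0=\{y_1,y_2\}\subseteq Y$. Let $G=\{A\subset X: |A|=3, x\in A, A\cap Y\ne\emptyset, A\cap Z\neq\emptyset\}\cup\{Y, Y_0\cup\{x\}, Z\cup\{y_1\}, Z\cup\{y_2\}\}$; the edges of $FP(n,r)$ are all $r$-subsets of $[n]$ containing a member of $G$. $3$-graphs on $n$ vertices: $H_0(n)$: special vertices $x,x_1,x_2$; all triples containing at least two of them. $H_1(n)$: special vertices $x,x_1,x_2,y_1$; all triples containing $\{x,x_1\}$, $\{x,x_2\}$ or $\{x,y_1\}$, plus $\{x_1,x_2,y_1\}$. $H_2(n)$: special vertices $x,x_1,x_2,y_1,y_2$; all triples containing $\{x,x_1\}$ or $\{x,x_2\}$, plus $\{x_1,x_2,y_1\},\{x_1,x_2,y_2\},\{x,y_1,y_2\}$.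 $H_3(n)$: special vertices $v_1,v_2,y_1,y_2,y_3$; all triples containing $\{v_1,v_2\}$ and the 6 triples consisting of one of $v_1,v_2$ and two of $y_1,y_2,y_3$. $H_4(n)$, $H_5(n)$: special vertices $v_1,v_2,a,a',b,b'$; both contain all triples containing $\{v_1,v_2\}$; additionally $H_4(n)$ contains $v_1aa',v_1bb',v_2ab,v_2ab',v_2a'b,v_2a'b'$ and $H_5(n)$ contains $v_1aa',v_1bb',v_1ab',v_2ab',v_2ab,v_2a'b'$. For $i=0,\ldots,5$, $H^r_i(n)$ is the $r$-graph on the same vertex set as $H_i(n)$ whose edges are all $r$-sets containing an edge of $H_i(n)$. *)

(* Defs.v *)
(* MathComp *)
From mathcomp Require Import all_boot.

Set Implicit Arguments.
Unset Strict Implicit.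
Unset Printing Implicit Defensive.

(* A hypergraph on the finite vertex type V is its edge family {set {set V}}. *)

Section Hypergraphs.
Variable V : finType.
Implicit Types (H F G : {set {set V}}) (A X Y Z : {set V}).

Definition r_graph (r : nat) H : Prop := {in H, forall A, #|A| = r}.

Definition intersecting H : Prop := {in H &, forall A B, A :&: B != set0}.

(* All r-subsets of V containing a member of G. *)
Definition superedges (r : nat) G : {set {set V}} :=
  [set e : {set V} | (#|e| == r) && [exists A in G, A \subset e]].

(* EM(n,r,1) with centre x. *)
Definition full_star (r : nat) (x : V) : {set {set V}} :=
  [set e : {set V} | (#|e| == r) && (x \in e)].

Definition FP_gen (x : V) Y Z (y1 y2 : V) : {set {set V}} :=
  [set A : {set V} | [&& A \subset x |: (Y :|: Z), #|A| == 3, x \in A,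
                         A :&: Y != set0 & A :&: Z != set0]]
  :|: [set Y; x |: [set y1; y2]; y1 |: Z; y2 |: Z].

(* F is a copy of FP(n,r) on V, where n = #|V|. The cardinalities force
   {x}, Y, Z to be pairwise disjoint. All copies on V are isomorphic, and
   they exist iff 2r <= n (for 2 <= r). *)
Definition is_FP (r : nat) F : Prop :=
  exists (x : V) (Y Z : {set V}) (y1 y2 : V),
    [/\ #|x |: (Y :|: Z)| = 2 * r, #|Y| = r, #|Z| = r.-1,
        [/\ y1 \in Y, y2 \in Y & y1 != y2]
      & F = superedges r (FP_gen x Y Z y1 y2)].

Definition triples_over A : {set {set V}} :=
  [set e : {set V} | (#|e| == 3) && (A \subset e)].

Definition H0 (x x1 x2 : V) : {set {set V}} :=
  [set e : {set V} | (#|e| == 3) && (2 <= #|e :&: [set x; x1; x2]|)].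

Definition H1 (x x1 x2 y1 : V) : {set {set V}} :=
  triples_over [set x; x1] :|: triples_over [set x; x2]
  :|: triples_over [set x; y1] :|: [set [set x1; x2; y1]].

Definition H2 (x x1 x2 y1 y2 : V) : {set {set V}} :=
  triples_over [set x; x1] :|: triples_over [set x; x2]
  :|: [set [set x1; x2; y1]; [set x1; x2; y2]; [set x; y1; y2]].

Definition H3 (v1 v2 y1 y2 y3 : V) : {set {set V}} :=
  triples_over [set v1; v2]
  :|: [set [set v1; y1; y2]; [set v1; y1; y3]; [set v1; y2; y3];
           [set v2; y1; y2]; [set v2; y1; y3]; [set v2; y2; y3]].

Definition H4 (v1 v2 a a' b b' : V) : {set {set V}} :=
  triples_over [set v1; v2]
  :|: [set [set v1; a; a']; [set v1; b; b'];
           [set v2; a; b]; [set v2; a; b'];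
           [set v2; a'; b]; [set v2; a'; b']].

Definition H5 (v1 v2 a a' b b' : V) : {set {set V}} :=
  triples_over [set v1; v2]
  :|: [set [set v1; a; a']; [set v1; b; b']; [set v1; a; b'];
           [set v2; a; b']; [set v2; a; b]; [set v2; a'; b']].

(* contained_Hi r H: H is contained in a copy of H_i^r(n), for some choice of
   pairwise distinct special vertices. *)
Definition contained_H0 (r : nat) H : Prop :=
  exists x x1 x2 : V,
    uniq [:: x; x1; x2] /\ H \subset superedges r (H0 x x1 x2).

Definition contained_H1 (r : nat) H : Prop :=
  exists x x1 x2 y1 : V,
    uniq [:: x; x1; x2; y1] /\ H \subset superedges r (H1 x x1 x2 y1).

Definition contained_H2 (r : nat) H : Prop :=
  exists x x1 x2 y1 y2 : V,
    uniq [:: x; x1; x2; y1; y2] /\ H \subset superedges r (H2 x x1 x2 y1 y2).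

Definition contained_H3 (r : nat) H : Prop :=
  exists v1 v2 y1 y2 y3 : V,
    uniq [:: v1; v2; y1; y2; y3] /\ H \subset superedges r (H3 v1 v2 y1 y2 y3).

Definition contained_H4 (r : nat) H : Prop :=
  exists v1 v2 a a' b b' : V,
    uniq [:: v1; v2; a; a'; b; b'] /\
    H \subset superedges r (H4 v1 v2 a a' b b').

Definition contained_H5 (r : nat) H : Prop :=
  exists v1 v2 a a' b b' : V,
    uniq [:: v1; v2; a; a'; b; b'] /\
    H \subset superedges r (H5 v1 v2 a a' b b').

Definition contained_EM (r : nat) H : Prop :=
  exists x : V, H \subset full_star r x.

End Hypergraphs.

(* Main.v *)
Require Import Defs.
From mathcomp Require Import all_boot.
From mathcomp Require Import zify.

(* Call A a kernel if every set S of at most r vertices disjoint from A is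
   missed by some edge containing A. Two kernels of size at most r meet: pick an
   edge e over the first missing the second, then an edge over the second
   missing e. If an edge contains no kernel of size at most 3, then starting from
   the empty set and extending a non-kernel k times by one of the at most r
   vertices of a blocking set S finds a k-set inside the edge, for k <= 4; so
   there are at most r^4 n^(r-4) such edges, and these are deleted. The triples
   containing a kernel form an intersecting 3-graph T. If T has a vertex cover
   {v1, v2}, the links of v1 and v2 are cross-intersecting graphs, and their
   possible shapes are exactly those of H_0, ..., H_5 or of a star. Otherwise
   |T| <= 12, so |H| <= 12 C(n,r-3) + O(n^(r-4)), which is less than |FP(n,r)|,
   since at least r(r-1)+1 >= 13 triples of X contain a generator of FP. *)

(** * Binomial estimates *)

Lemma ffact_leq_exp n m : n ^_ m <= n ^ m.
Proof.
elim: m n => [|m IHm] n; first by rewrite ffactn0.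
by rewrite ffactnSr expnSr leq_mul ?leq_subr.
Qed.

Lemma exp_leq_ffact n m : (n - m) ^ m <= n ^_ m.
Proof.
elim: m n => [|m IHm] n; first by rewrite ffactn0.
rewrite ffactnSr expnSr leq_mul ?leq_sub2l //.
apply: leq_trans (IHm n); case: m {IHm} => // m.
by rewrite leq_exp2r // leq_sub2l.
Qed.

Lemma bin_leq_exp n m : 'C(n, m) <= n ^ m.
Proof.
apply: leq_trans (ffact_leq_exp n m).
by rewrite -bin_ffact leq_pmulr // fact_gt0.
Qed.

(** Bernoulli's inequality (1 - c/n)^(m+1) >= 1 - c(m+1)/n with denominators cleared and the
    negative term moved across, so that truncated subtraction occurs only in [n - c]. *)
Lemma bernoulli_nat n c m : c <= n ->
  n ^ m.+1 <= (n - c) ^ m.+1 + c * m.+1 * n ^ m.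
Proof.
move=> le_cn; elim: m => [|m IHm].
  by rewrite !expn1 expn0 !muln1 subnK.
(* Multiplying the induction hypothesis by [n] leaves n (n-c)^(m+1) = (n-c)^(m+2) + c (n-c)^(m+1),
   and [le_exp] bounds the last term by c n^(m+1). *)
have le_exp : (n - c) ^ m.+1 <= n ^ m.+1 by rewrite leq_exp2r // leq_subr.
move: IHm le_exp; rewrite !(expnS _ m.+1).
have -> : n ^ m.+1 = n * n ^ m by rewrite expnS.
nia.
Qed.

(** Times (r-3)!, the two sides are led by 12 n^(r-3) and 13 n^(r-3). The losses are at most 13 * 3r
    * (r-3) * n^(r-4) from the shift and r! * r^4 * n^(r-4) from the added term; the threshold on
    [n] dominates their sum. *)
Lemma binomial_gap r n : 4 <= r ->
  39 * r * r + r`! * r ^ 4 < n ->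
  12 * 'C(n, r - 3) + r ^ 4 * n ^ (r - 4) < 13 * 'C(n - 2 * r, r - 3).
Proof.
move: (r ^ 4) => K hr hn; have -> : r - 3 = (r - 4).+1 by lia.
have le_m_r : (r - 4).+1 <= r by lia.
set m := r - 4 in le_m_r *.
rewrite -(ltn_pmul2r (fact_gt0 m.+1)) mulnDl -!mulnA !bin_ffact.
have le_fact : m.+1`! <= r`! by apply: leq_fact.
have le3r : 3 * r <= n by nia.
have up := ffact_leq_exp n m.+1.
(* The shift 3r covers the 2r removed vertices and a drop of at most r across the factors of the
   falling factorial. *)
have low : (n - 3 * r) ^ m.+1 <= (n - 2 * r) ^_ m.+1.
  apply: leq_trans (exp_leq_ffact _ _); rewrite leq_exp2r //; lia.
have bern := @bernoulli_nat n (3 * r) m le3r.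
have npos : 0 < n ^ m by rewrite expn_gt0; lia.
have gap : (39 * r * r + r`! * K) * n ^ m < n * n ^ m.
  by rewrite ltn_pmul2r.
have le1 : 39 * r * m.+1 * n ^ m <= 39 * r * r * n ^ m.
  by rewrite leq_mul2r leq_mul2l le_m_r !orbT.
have le2 : K * (n ^ m * m.+1`!) <= r`! * K * n ^ m.
  by rewrite mulnA -[X in _ <= X]mulnA [X in _ <= X]mulnC leq_mul2l le_fact orbT.
move: up low le1 le2 bern gap; rewrite mulnDl expnS -!mulnA.
move: (n ^_ _) => a; move: (_ ^_ _) => b; move: (n * _) => c; move: (_ ^ m.+1) => d.
move: (r * (m.+1 * _)) (r`! * _) (K * _) => x y z.
by move: (r * (r * _)) => w; lia.
Qed.

(** * Union bound and supersets of a fixed set *)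

Lemma leq_card_bigcup {I V : finType} (P : pred I) (F : I -> {set V}) :
  #|\bigcup_(i | P i) F i| <= \sum_(i | P i) #|F i|.
Proof.
apply: (big_ind2 (fun (A : {set V}) k => #|A| <= k)) => [|A a B b leA leB|//].
  by rewrite cards0.
by apply: leq_trans (leq_card_setU _ _) (leq_add leA leB).
Qed.

Lemma card_supersets_leq {V : finType} r (A : {set V}) :
  #|[set e : {set V} | (#|e| == r) && (A \subset e)]| <= 'C(#|V|, r - #|A|).
Proof.
rewrite -[#|V|]cardsT -cards_draws.
rewrite -(card_in_imset (f := fun e => e :\: A)); last first.
  move=> e f; rewrite !inE => /andP[_ sAe] /andP[_ sAf] eqD.
  by rewrite -(setID e A) -(setID f A) eqD (setIidPr sAe) (setIidPr sAf).
apply/subset_leq_card/subsetP => _ /imsetP[e + ->].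
by rewrite !inE => /andP[/eqP <- sAe]; rewrite subsetT cardsDS /=.
Qed.

(** * Kernels *)

(** The core of a sunflower with more than [r] petals in [H] is such a set; this weaker blocking
    condition already supports the exchange argument of [kernel_meet]. *)
Definition kernel {V : finType} (r : nat) (H : {set {set V}}) (A : {set V}) :=
  [forall S : {set V}, (#|S| <= r) && [disjoint A & S] ==>
     [exists e in H, (A \subset e) && [disjoint e & S]]].

Definition kernel_free {V : finType} (r : nat) (H : {set {set V}}) :=
  [set e in H | [forall A : {set V}, kernel r H A && (A \subset e) ==> (3 < #|A|)]].

Definition kernel_triples {V : finType} (r : nat) (H : {set {set V}}) :=
  [set t : {set V} | (#|t| == 3) && [exists A : {set V}, kernel r H A && (A \subset t)]].

Lemma kernelP {V : finType} r (H : {set {set V}}) (A S : {set V}) :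
    kernel r H A -> #|S| <= r -> [disjoint A & S] ->
  exists2 e, e \in H & (A \subset e) && [disjoint e & S].
Proof.
move=> /forallP/(_ S)/implyP kA leS dAS.
by have /exists_inP[e He sd] := kA (introT andP (conj leS dAS)); exists e.
Qed.

Lemma kernel_meet {V : finType} r (H : {set {set V}}) (A B : {set V}) :
    r_graph r H -> intersecting H -> #|B| <= r ->
  kernel r H A -> kernel r H B -> A :&: B != set0.
Proof.
move=> rH iH leB kA kB; apply/negP => /eqP AB0.
have [e He /andP[_ deB]] : exists2 e, e \in H & (A \subset e) && [disjoint e & B].
  by apply: kernelP kA leB _; rewrite -setI_eq0 AB0.
have [f Hf /andP[_ dfe]] : exists2 f, f \in H & (B \subset f) && [disjoint f & e].
  by apply: kernelP kB _ _; rewrite ?rH // disjoint_sym.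
by have /negP[] := iH f e Hf He; rewrite setI_eq0.
Qed.

(** Induction on the number [k] of vertices by which [A] falls short of four. Each is chosen from a
    blocking set and costs a factor [r]; over a set of four vertices at most ['C(#|V|, r - 4)] edges
    remain. *)
Lemma card_kernel_free_over {V : finType} r (H : {set {set V}}) k (A : {set V}) :
    r_graph r H -> 4 <= r -> k <= 4 -> #|A| = 4 - k ->
  #|[set e in kernel_free r H | A \subset e]| <= r ^ k * #|V| ^ (r - 4).
Proof.
move=> rH hr; elim: k A => [|k IHk] A lek cardA.
  rewrite mul1n; apply: leq_trans (bin_leq_exp _ _).
  have := card_supersets_leq r A; rewrite cardA; apply: leq_trans.
  apply/subset_leq_card/subsetP => e; rewrite !inE => /andP[/andP[He _] ->].
  by rewrite rH ?eqxx.
have [kA|] := boolP (kernel r H A).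
  rewrite (_ : [set e in _ | _] = set0) ?cards0 //.
  apply/setP => e; rewrite !inE; apply/negbTE/negP => /andP[/andP[_ /forallP/(_ A)]].
  by move=> + sAe; rewrite kA sAe cardA /=; lia.
rewrite negb_forall => /existsP[S]; rewrite negb_imply => /andP[/andP[leS dAS] noe].
(* Every edge over [A] meets the blocking set [S], so the edges are sorted by a vertex of [S];
   disjointness of [S] from [A] makes each extension of [A] strictly larger. *)
have : #|[set e in kernel_free r H | A \subset e]| <=
       \sum_(s in S) #|[set e in kernel_free r H | s |: A \subset e]|.
  apply: leq_trans (leq_card_bigcup _ _).
  apply/subset_leq_card/subsetP => e; rewrite inE => /andP[Fe sAe].
  have He : e \in H by move: Fe; rewrite inE => /andP[].
  move: noe; rewrite negb_exists => /forallP/(_ e); rewrite He sAe /=.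
  rewrite -setI_eq0 => /set0Pn[s /setIP[es Ss]].
  by apply/bigcupP; exists s => //; rewrite !inE subUset sub1set es sAe in Fe *; rewrite Fe.
move=> /leq_trans-> //.
apply: leq_trans (_ : \sum_(s in S) r ^ k * #|V| ^ (r - 4) <= _).
  apply: leq_sum => s Ss; apply: IHk; first exact: ltnW.
  rewrite cardsU1 cardA; have -> /= : s \notin A by rewrite (disjointFl dAS).
  by lia.
by rewrite sum_nat_const expnS -mulnA leq_mul2r leS orbT.
Qed.

Lemma card_kernel_free {V : finType} r (H : {set {set V}}) :
    r_graph r H -> 4 <= r ->
  #|kernel_free r H| <= r ^ 4 * #|V| ^ (r - 4).
Proof.
move=> rH hr; have := @card_kernel_free_over V r H 4 set0 rH hr (leqnn 4).
rewrite cards0 => /(_ erefl); apply: leq_trans.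
by apply/subset_leq_card/subsetP => e Fe; rewrite inE Fe sub0set.
Qed.

Lemma kernel_triples_card {V : finType} r (H : {set {set V}}) :
  r_graph 3 (kernel_triples r H).
Proof. by move=> t; rewrite inE => /andP[/eqP]. Qed.

Lemma kernel_triples_intersecting {V : finType} r (H : {set {set V}}) :
    r_graph r H -> intersecting H -> 4 <= r ->
  intersecting (kernel_triples r H).
Proof.
move=> rH iH hr t s; rewrite !inE.
move=> /andP[_ /existsP[A /andP[kA sAt]]] /andP[/eqP card_s /existsP[B /andP[kB sBs]]].
have leB : #|B| <= r by move: (subset_leq_card sBs); lia.
have /set0Pn[v /setIP[Av Bv]] := @kernel_meet _ _ _ _ _ rH iH leB kA kB.
by apply/set0Pn; exists v; rewrite inE (subsetP sAt) // (subsetP sBs).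
Qed.

Lemma exists_triple_between {V : finType} (A e : {set V}) :
  A \subset e -> #|A| <= 3 -> 3 <= #|e| ->
  exists t : {set V}, [/\ #|t| = 3, A \subset t & t \subset e].
Proof.
move=> sAe leA lee.
have [B sB cB] : exists2 B : {set V}, B \subset e :\: A & #|B| == 3 - #|A|.
  have := cards_draws (e :\: A) (3 - #|A|); rewrite cardsDS // => cd.
  have : 0 < #|[set B : {set V} | (B \subset e :\: A) && (#|B| == 3 - #|A|)]|.
    by rewrite cd bin_gt0; lia.
  by case/card_gt0P => B; rewrite inE => /andP[]; exists B.
move: sB; rewrite subsetD => /andP[sBe dBA].
exists (A :|: B); rewrite subsetUl subUset sAe sBe; split=> //.
by rewrite cardsU setIC (disjoint_setI0 dBA) cards0 (eqP cB); lia.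
Qed.

(** An edge that is not deleted contains a kernel of size at most 3; padding it with further
    vertices of the edge yields a kernel triple inside the edge. *)
Lemma kernel_free_complement {V : finType} r (H : {set {set V}}) :
    r_graph r H -> 4 <= r ->
  H :\: kernel_free r H \subset superedges r (kernel_triples r H).
Proof.
move=> rH hr; apply/subsetP => e; rewrite !inE => /andP[+ He].
rewrite He /= rH // eqxx negb_forall => /existsP[A].
rewrite negb_imply -leqNgt => /andP[/andP[kA sAe] leA].
have [|t [ct sAt ste]] := @exists_triple_between V A e sAe leA; first by rewrite rH //; lia.
apply/exists_inP; exists t => //; rewrite inE ct eqxx.
by apply/existsP; exists A; rewrite kA.
Qed.

(** * Intersecting 3-graphs without a cover of size two *)

Lemma card3_eq {V : finType} (t : {set V}) a b c :
    #|t| = 3 -> uniq [:: a; b; c] -> a \in t -> b \in t -> c \in t ->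
  t = [set a; b; c].
Proof.
move=> ct; rewrite /= !inE negb_or andbT => /andP[/andP[ab ac] bc] ta tb tc.
apply/esym/eqP; rewrite eqEcard; apply/andP; split.
  by apply/subsetP => v; rewrite !inE => /orP[/orP[]|] /eqP->.
by rewrite ct setUC cardsU1 cards2 ab !inE negb_or eq_sym ac eq_sym bc.
Qed.

Lemma cards3P {V : finType} (t : {set V}) :
  #|t| = 3 -> exists a b c, uniq [:: a; b; c] /\ t = [set a; b; c].
Proof.
move=> ct; have /card_gt0P[a ta] : 0 < #|t| by rewrite ct.
have := cardsD1 a t; rewrite ct ta add1n => -[]/esym/eqP/cards2P[b [c [bc e]]].
have [bt ct'] : b \in t :\ a /\ c \in t :\ a by rewrite e !inE !eqxx orbT.
move: bt ct'; rewrite !inE => /andP[ba tb] /andP[ca tc].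
have u : uniq [:: a; b; c] by rewrite /= !inE negb_or eq_sym ba eq_sym ca bc.
by exists a, b, c; split=> //; apply: card3_eq.
Qed.

(** A member of [F] has the form {c, u, w} with [w] in [S], so it is determined by its third
    vertex. *)
Lemma card_over_pair {V : finType} (F : {set {set V}}) (S : {set V}) c u :
    r_graph 3 F -> c != u ->
    (forall t, t \in F ->
       [/\ c \in t, u \in t & exists2 w, w \in S & [&& w \in t, w != c & w != u]]) ->
  #|F| <= #|S|.
Proof.
move=> F3 cu FS; apply: leq_trans (leq_imset_card (fun w => [set c; u; w]) S).
apply/subset_leq_card/subsetP => t Ft; have [ct ut [w Sw /and3P[tw wc wu]]] := FS t Ft.
apply/imsetP; exists w => //; apply: card3_eq => //; first exact: F3.
by rewrite /= !inE negb_or cu eq_sym wc eq_sym wu.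
Qed.

(* Taking [u = v], this also excludes covers by a single vertex. *)
Definition no_2cover {V : finType} (T : {set {set V}}) : Prop :=
  forall u v, exists2 t, t \in T & (u \notin t) && (v \notin t).

(** For a triple [e] of an intersecting 3-graph, [meet_at] and [meet_but] sort the other edges:
    those sharing one vertex with [e] by that vertex, those sharing two by the vertex of [e] they
    omit. *)
Definition meet_at {V : finType} (T : {set {set V}}) (e : {set V}) c :=
  [set t in T | t :&: e == [set c]].

Definition meet_but {V : finType} (T : {set {set V}}) (e : {set V}) c :=
  [set t in T | t :&: e == e :\ c].

Lemma meet_atP {V : finType} {T : {set {set V}}} {e t : {set V}} {c} :
    t \in meet_at T e c ->
  [/\ t \in T, c \in t & forall v, v \in t -> v \in e -> v = c].
Proof.
rewrite inE => /andP[Tt /eqP te]; split=> //.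
  by have := set11 c; rewrite -te inE => /andP[].
by move=> v tv ev; apply/set1P; rewrite -te inE tv.
Qed.

(* An edge g missing c and u meets e, hence offers at most two vertices outside e
   for the third vertex of t. *)
Lemma card_meet_at_through {V : finType} (T : {set {set V}}) e c u :
    r_graph 3 T -> intersecting T -> no_2cover T ->
    e \in T -> c \in e -> u \notin e ->
  #|[set t in meet_at T e c | u \in t]| <= 2.
Proof.
move=> T3 iT nT Te ec eu; have [g Tg /andP[gc gu]] := nT c u.
have leS : #|g :\: e| <= 2.
  have := cardsID e g; rewrite (T3 g Tg).
  by have := iT _ _ Tg Te; rewrite -card_gt0; lia.
apply: leq_trans leS; apply: (@card_over_pair _ _ _ c u).
- by move=> t; rewrite !inE => /andP[/andP[/T3]].
- by apply: contraNneq eu => <-.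
move=> t; rewrite inE => /andP[/meet_atP[Tt ct te] ut]; split=> //.
have /set0Pn[w /setIP[tw gw]] := iT _ _ Tt Tg; exists w.
  by rewrite inE gw andbT; apply: contra gc => ew; rewrite -(te w tw ew).
by rewrite tw /=; apply/andP; split; [apply: contraNneq gc | apply: contraNneq gu] => <-.
Qed.

(** The other two vertices of [e] are not a cover; an edge avoiding both can meet [e] only in
    [c]. *)
Lemma meet_at_neq0 {V : finType} (T : {set {set V}}) (e : {set V}) c :
    r_graph 3 T -> intersecting T -> no_2cover T -> e \in T -> c \in e ->
  exists n, n \in meet_at T e c.
Proof.
move=> T3 iT nT Te ec; have := cardsD1 c e; rewrite (T3 e Te) ec add1n.
move=> -[]/esym/eqP/cards2P[a [b [_ eab]]].
have [n Tn /andP[na nb]] := nT a b; exists n; rewrite inE Tn /=.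
have sub : n :&: e \subset [set c].
  apply/subsetP => v /setIP[nv ev]; rewrite inE; apply: contraT => vc.
  have : v \in e :\ c by rewrite !inE vc.
  by rewrite eab !inE => /orP[] /eqP vE; rewrite -vE nv in na nb.
move: sub; rewrite subset1 => /orP[//|/eqP ne0].
by have := iT _ _ Tn Te; rewrite ne0 eqxx.
Qed.

Lemma meet_at_pair {V : finType} (T : {set {set V}}) (e n : {set V}) c :
    r_graph 3 T -> n \in meet_at T e c ->
  exists p q, [/\ p != q, p \notin e, q \notin e & n = [set c; p; q]].
Proof.
move=> T3 /meet_atP[Tn nc ne]; have := cardsD1 c n; rewrite (T3 n Tn) nc add1n.
move=> -[]/esym/eqP/cards2P[p [q [pq npq]]].
have out v : v \in n :\ c -> v \notin e.
  by rewrite !inE => /andP[vc nv]; apply: contraNN vc => ev; rewrite (ne v nv ev).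
exists p, q; split=> //; first by apply: out; rewrite npq !inE eqxx.
  by apply: out; rewrite npq !inE eqxx orbT.
by rewrite -setUA -npq setD1K.
Qed.

(** An edge meeting [e] only in [a] cannot meet {b, p, q} in [b], so it passes through [p] or
    [q]. *)
Lemma meet_at_split {V : finType} (T : {set {set V}}) (e : {set V}) a b p q :
    intersecting T -> a \in e -> b \in e -> a != b -> [set b; p; q] \in T ->
  meet_at T e a = [set t in meet_at T e a | p \in t] :|: [set t in meet_at T e a | q \in t].
Proof.
move=> iT ea eb ab Tn; apply/setP => t; rewrite in_setU !inE -andb_orr.
apply/esym/andb_idr => tN; have [|Tt at' te] := @meet_atP _ T e t a; first by rewrite inE.
have /set0Pn[w] := iT _ _ Tt Tn; rewrite !inE => /andP[tw /orP[/orP[]|] /eqP wE].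
- by move: ab; rewrite -(te w tw) ?wE ?eqxx.
- by rewrite -wE tw.
- by rewrite -wE tw orbT.
Qed.

(** Some edge {b, p, q} meets [e] only in another vertex [b]. The edges at [a] pass through [p] or
    [q], at most two through each. *)
Lemma card_meet_at {V : finType} (T : {set {set V}}) (e : {set V}) a :
    r_graph 3 T -> intersecting T -> no_2cover T -> e \in T -> a \in e ->
  #|meet_at T e a| <= 4.
Proof.
move=> T3 iT nT Te ea.
have /card_gt0P[b] : 0 < #|e :\ a| by have := cardsD1 a e; rewrite (T3 e Te) ea; lia.
rewrite !inE => /andP[ba eb].
have [n Nn] := @meet_at_neq0 _ T e b T3 iT nT Te eb.
have [p [q [_ pe qe nE]]] := @meet_at_pair _ T e n b T3 Nn.
have [Tn _ _] := meet_atP Nn.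
rewrite (@meet_at_split _ T e a b p q) // 1?eq_sym -?nE //.
apply: leq_trans (leq_card_setU _ _) _; rewrite -[4]/(2 + 2).
by apply: leq_add; apply: card_meet_at_through.
Qed.

(** [t] has a single vertex outside [e]. Since [n] meets [e] only in the vertex [c] missed by [t],
    the two edges meet at that outside vertex. *)
Lemma meet_but_out {V : finType} (T : {set {set V}}) (e t n : {set V}) c w :
    r_graph 3 T -> intersecting T -> e \in T -> c \in e ->
    t \in meet_but T e c -> n \in meet_at T e c ->
  w \in t -> w \notin e -> w \in n.
Proof.
move=> T3 iT Te ec; rewrite inE => /andP[Tt /eqP te] /meet_atP[Tn nc ne] tw ew.
have /set0Pn[v /setIP[tv nv]] := iT _ _ Tt Tn.
have ev : v \notin e.
  apply/negP => ev; have vc := ne v nv ev.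
  by have : v \in e :\ c; [rewrite -te inE tv | rewrite vc !inE eqxx].
have : #|t :\: e| = 1.
  have := cardsID e t; rewrite te (T3 t Tt).
  by have := cardsD1 c e; rewrite (T3 e Te) ec; lia.
move/eqP/cards1P => [x tx].
have : w \in t :\: e by rewrite inE ew.
have : v \in t :\: e by rewrite inE ev.
by rewrite tx !inE => /eqP vx /eqP->; rewrite -vx.
Qed.

(* S collects the possible third vertices of edges over [e :\ c]: each of them
   lies in every edge meeting e at c only. *)
Lemma card_meet_local {V : finType} (T : {set {set V}}) (e : {set V}) c :
    r_graph 3 T -> intersecting T -> no_2cover T -> e \in T -> c \in e ->
  #|meet_but T e c| + #|meet_at T e c| <= 3 + (#|meet_at T e c| == 4).
Proof.
move=> T3 iT nT Te ec.
set S := [set w | (w \notin e) && [forall n in meet_at T e c, w \in n]].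
have leS : #|meet_but T e c| <= #|S|.
  have := cardsD1 c e; rewrite (T3 e Te) ec add1n.
  move=> -[]/esym/eqP/cards2P[a [b [ab eab]]].
  apply: (@card_over_pair _ _ _ a b) => //.
    by move=> t; rewrite inE => /andP[/T3].
  move=> t Et; have := Et; rewrite inE => /andP[Tt /eqP te].
  have sub : [set a; b] \subset t by rewrite -eab -te subsetIl.
  have /card_gt0P[w] : 0 < #|t :\: e|.
    have := cardsID e t; rewrite te (T3 t Tt).
    by have := cardsD1 c e; rewrite (T3 e Te) ec; lia.
  rewrite inE => /andP[we wt].
  have out v : v \in [set a; b] -> w != v.
    by rewrite -eab !inE => /andP[_]; apply: contraTneq => <-.
  split; [by apply: (subsetP sub); rewrite !inE eqxx | by apply: (subsetP sub); rewrite !inE eqxx orbT|].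
  exists w; last by rewrite wt !out // !inE eqxx ?orbT.
  rewrite inE we; apply/forall_inP => n Nn.
  exact: (@meet_but_out _ T e t n c w).
have [n Nn] := @meet_at_neq0 _ T e c T3 iT nT Te ec.
have [Tn nc ne] := meet_atP Nn.
have le4 := @card_meet_at _ T e c T3 iT nT Te ec.
(* With [S] empty there is no edge over [e :\ c], and only the bound 4 on [meet_at] counts; the
   boolean summand allows for the value 4. *)
have [S0|] := eqVneq S set0; first by move: leS; rewrite S0 cards0; case: eqP; lia.
case/set0Pn => w Sw; have := Sw; rewrite inE => /andP[we /forall_inP wN].
have le2 : #|meet_at T e c| <= 2.
  apply: leq_trans (@card_meet_at_through _ T e c w T3 iT nT Te ec we).
  by apply/subset_leq_card/subsetP => t Nt; rewrite inE Nt wN.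
(* With one vertex in [S] the total is at most 1 + 2. With more, every edge at [c] contains [S] and
   [c], which forces |S| = 2 and a single edge at [c], for a total of 2 + 1. *)
have [le1|lt1] := leqP #|S| 1; first by lia.
have SN m : m \in meet_at T e c -> S :|: [set c] \subset m.
  move=> Nm; have [_ mc _] := meet_atP Nm; rewrite subUset sub1set mc andbT.
  by apply/subsetP => v; rewrite inE => /andP[_ /forall_inP]; apply.
have cSc : #|S :|: [set c]| = #|S|.+1.
  by rewrite setUC cardsU1 inE ec.
have ltS : #|S| <= 2 by have := subset_leq_card (SN n Nn); rewrite cSc (T3 n Tn).
have : #|meet_at T e c| <= #|[set S :|: [set c]]|.
  apply/subset_leq_card/subsetP => m Nm; rewrite inE eq_sym eqEcard SN //.
  by have [Tm _ _] := meet_atP Nm; rewrite T3 // cSc.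
by rewrite cards1; lia.
Qed.

Lemma meet_at_through_pair {V : finType} (T : {set {set V}}) (e : {set V}) a p :
    r_graph 3 T -> a \in e -> p \notin e ->
    #|[set t in meet_at T e a | p \in t]| = 2 ->
  exists x1 x2, [/\ x1 != x2, x1 \notin e, x2 \notin e,
    [set a; p; x1] \in meet_at T e a & [set a; p; x2] \in meet_at T e a].
Proof.
move=> T3 ea pe /eqP/cards2P[t1 [t2 [t12 tE]]].
have third t : t \in [set t in meet_at T e a | p \in t] ->
    exists2 x, x \notin e & t = [set a; p; x] /\ t \in meet_at T e a.
  rewrite inE => /andP[Nt pt].
  have [y [z [yz ye ze nE]]] := @meet_at_pair _ T e t a T3 Nt.
  have := pt; rewrite {1}nE !in_setU !in_set1 => /orP[/orP[]|] /eqP pE.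
  - by rewrite pE ea in pe.
  - by exists z => //; rewrite pE -nE.
  - by exists y => //; rewrite pE setUAC -nE.
have [|x1 x1e [t1E N1]] := third t1; first by rewrite tE !inE eqxx.
have [|x2 x2e [t2E N2]] := third t2; first by rewrite tE !inE eqxx orbT.
exists x1, x2; split; rewrite -?t1E -?t2E //.
by apply: contraNneq t12 => xE; rewrite t1E t2E xE.
Qed.

(* With an edge [b; p; q], the four edges at a are {a,p,y1}, {a,p,y2}, {a,q,x1},
   {a,q,x2}, and only [b; p; q] and [b; y1; y2] can meet all of them. *)
Lemma card_meet_at_pair {V : finType} (T : {set {set V}}) (e : {set V}) a b :
    r_graph 3 T -> intersecting T -> no_2cover T -> e \in T ->
    a \in e -> b \in e -> a != b -> #|meet_at T e a| = 4 ->
  #|meet_at T e b| <= 2.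
Proof.
move=> T3 iT nT Te ea eb ab Na4.
have [n Nn] := @meet_at_neq0 _ T e b T3 iT nT Te eb.
have [p [q [pq pe qe nE]]] := @meet_at_pair _ T e n b T3 Nn.
have [Tn _ _] := meet_atP Nn.
have := @meet_at_split _ T e a b p q iT ea eb ab; rewrite -nE => /(_ Tn) split.
have lep := @card_meet_at_through _ T e a p T3 iT nT Te ea pe.
have leq' := @card_meet_at_through _ T e a q T3 iT nT Te ea qe.
have := Na4; rewrite split cardsU => cardU.
(* Four edges covered by two families of size at most two force both sizes to be 2 and, as [apq]
   records, leave no common member. *)
have [cp cq] : #|[set t in meet_at T e a | p \in t]| = 2 /\ #|[set t in meet_at T e a | q \in t]| = 2.
  by move: lep leq' cardU; move: #|_| #|_| => x y; lia.
have apq t : t \in meet_at T e a -> p \in t -> q \in t -> false.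
  move=> Nt tp tq; have: 0 < #|[set t in meet_at T e a | p \in t] :&: [set t in meet_at T e a | q \in t]|.
    by apply/card_gt0P; exists t; move: Nt; rewrite !inE tp tq => ->.
  by move: cardU; rewrite cp cq; move: #|_| => x; lia.
have [y1 [y2 [y12 y1e y2e Ny1 Ny2]]] := @meet_at_through_pair _ T e a p T3 ea pe cp.
have [x1 [x2 [x12 x1e x2e Nx1 Nx2]]] := @meet_at_through_pair _ T e a q T3 ea qe cq.
(* [m] meets [e] only in [b] and {a, u, z} meets [e] only in [a], so the common vertex is [u] or
   [z]. *)
have meet m u z : m \in meet_at T e b -> [set a; u; z] \in meet_at T e a -> u \notin m -> z \in m.
  move=> /meet_atP[Tm mb me] /meet_atP[Tt _ _] um.
  have /set0Pn[w] := iT _ _ Tm Tt; rewrite !inE => /andP[mw /orP[/orP[]|] /eqP wE].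
  - by move: ab; rewrite -(me w mw) ?wE ?eqxx.
  - by rewrite -wE mw in um.
  - by rewrite -wE.
(* Such an [m] would consist of [u], [z1], [z2], all outside [e], leaving no room for [b]. *)
have full m u v z1 z2 : m \in meet_at T e b -> u \in m -> v \notin m -> u \notin e ->
    z1 != z2 -> z1 \notin e -> z2 \notin e ->
    [set a; v; z1] \in meet_at T e a -> [set a; v; z2] \in meet_at T e a ->
    u != z1 -> u != z2 -> false.
  move=> Nm um vm ue z12 z1e z2e N1 N2 uz1 uz2.
  have [Tm mb _] := meet_atP Nm.
  have z1m := @meet m v z1 Nm N1 vm; have z2m := @meet m v z2 Nm N2 vm.
  have bn z : z \notin e -> b != z by apply: contraNneq => <-.
  have m1 : m = [set u; z1; z2].
    by apply: card3_eq => //; [exact: T3 | rewrite /= !inE negb_or uz1 uz2 z12].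
  by move: mb; rewrite m1 !inE (negbTE (bn u ue)) (negbTE (bn _ z1e)) (negbTE (bn _ z2e)).
have bn z : z \notin e -> b != z by apply: contraNneq => <-.
apply: leq_trans (_ : #|[set [set b; p; q]; [set b; y1; y2]]| <= 2); last by rewrite cards2; case: (_ != _).
apply/subset_leq_card/subsetP => m Nm; have [Tm mb _] := meet_atP Nm.
rewrite !inE; have [pm|pm] := boolP (p \in m); have [qm|qm] := boolP (q \in m).
- apply/orP; left; apply/eqP/card3_eq => //; first exact: T3.
  by rewrite /= !inE negb_or !bn // pq.
- suff [h1 h2] : p != x1 /\ p != x2.
    by have := @full m p q x1 x2 Nm pm qm pe x12 x1e x2e Nx1 Nx2 h1 h2.
  split.
  + by apply/eqP => pE; have := apq _ Nx1; rewrite pE !inE !eqxx !orbT => /(_ isT isT).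
  + by apply/eqP => pE; have := apq _ Nx2; rewrite pE !inE !eqxx !orbT => /(_ isT isT).
- suff [h1 h2] : q != y1 /\ q != y2.
    by have := @full m q p y1 y2 Nm qm pm qe y12 y1e y2e Ny1 Ny2 h1 h2.
  split.
  + by apply/eqP => pE; have := apq _ Ny1; rewrite pE !inE !eqxx !orbT => /(_ isT isT).
  + by apply/eqP => pE; have := apq _ Ny2; rewrite pE !inE !eqxx !orbT => /(_ isT isT).
- apply/orP; right; apply/eqP/card3_eq => //; first exact: T3.
  + by rewrite /= !inE negb_or !bn // y12.
  + exact: (@meet m p).
  + exact: (@meet m p).
Qed.

(* The sharp bound is 10; 12 suffices, being less than r(r-1)+1 for r >= 4. *)
Lemma card_no_2cover {V : finType} (T : {set {set V}}) :
  r_graph 3 T -> intersecting T -> no_2cover T -> #|T| <= 12.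
Proof.
move=> T3 iT nT; have [->|] := eqVneq T set0; first by rewrite cards0.
case/set0Pn => e Te; have [a [b [c [u eE]]]] := @cards3P _ e (T3 e Te).
have sub : T \subset [set e] :|:
    ((meet_but T e a :|: meet_at T e a) :|: (meet_but T e b :|: meet_at T e b)
     :|: (meet_but T e c :|: meet_at T e c)).
  apply/subsetP => t Tt.
  suff [->|[v ev]] : t = e \/ exists2 v, v \in e & t \in meet_but T e v :|: meet_at T e v.
  - by rewrite in_setU set11.
  - move: ev; rewrite eE !inE -orbA => ev; case/or3P: ev => /eqP-> /orP[] ->; rewrite ?orbT //.
  have c0 : 0 < #|t :&: e| by rewrite card_gt0 iT.
  have cD := cardsID t e; rewrite setIC (T3 e Te) in cD.
  have [c1|c1] := eqVneq #|t :&: e| 1.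
    right; have /cards1P[v vE] : #|t :&: e| == 1 by rewrite c1.
    have : v \in t :&: e by rewrite vE set11.
    by rewrite inE => /andP[_ ev]; exists v => //; rewrite !inE Tt vE eqxx orbT.
  have [c2|c2] := eqVneq #|t :&: e| 2.
    right; have /cards1P[v vE] : #|e :\: t| == 1 by lia.
    have : v \in e :\: t by rewrite vE set11.
    rewrite inE => /andP[_ ev]; exists v => //; rewrite !inE Tt -vE.
    by rewrite setDDr setDv set0U setIC eqxx.
  left; have te : e \subset t by rewrite -setD_eq0 -cards_eq0; lia.
  by apply/esym/eqP; rewrite eqEcard te !T3.
have := subset_leq_card sub.
have le (A B : {set {set V}}) : #|A :|: B| <= #|A| + #|B| by exact: leq_card_setU.
have ea : a \in e by rewrite eE !inE eqxx.
have eb : b \in e by rewrite eE !inE eqxx orbT.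
have ec : c \in e by rewrite eE !inE eqxx !orbT.
have leA := @card_meet_local _ T e a T3 iT nT Te ea.
have leB := @card_meet_local _ T e b T3 iT nT Te eb.
have leC := @card_meet_local _ T e c T3 iT nT Te ec.
move: u; rewrite /= !inE negb_or andbT => /andP[/andP[ab ac] bc].
have Lab := @card_meet_at_pair _ T e a b T3 iT nT Te ea eb ab.
have Lac := @card_meet_at_pair _ T e a c T3 iT nT Te ea ec ac.
have Lbc := @card_meet_at_pair _ T e b c T3 iT nT Te eb ec bc.
(* By [Lab], [Lac] and [Lbc] at most one of the three [meet_at] counts is 4, so at most one local
   bound rises from 3 to 4. The sum stays within 11, and [e] itself brings it to 12. *)
have key : (#|meet_but T e a| + #|meet_at T e a|) + (#|meet_but T e b| + #|meet_at T e b|)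
    + (#|meet_but T e c| + #|meet_at T e c|) <= 11.
  move: leA leB leC Lab Lac Lbc.
  move: #|meet_but T e a| #|meet_at T e a| #|meet_but T e b| #|meet_at T e b|.
  move: #|meet_but T e c| #|meet_at T e c| => x1 y1 x2 y2 x3 y3.
  by do 3![case: eqP => [->|_]]; lia.
move=> /leq_trans-> //.
apply: leq_trans (le _ _) _; rewrite cards1 (leq_add2l 1 _ 11).
apply: leq_trans key; apply: leq_trans (le _ _) _; apply: leq_add (le _ _).
by apply: leq_trans (le _ _) _; apply: leq_add (le _ _) (le _ _).
Qed.

(** * Cross-intersecting graphs *)

Lemma meet_pairE {V : finType} (g : {set V}) a b :
  (g :&: [set a; b] != set0) = (a \in g) || (b \in g).
Proof.
apply/set0Pn/orP => [[v]|[ag|bg]].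
- by rewrite !inE => /andP[gv /orP[]/eqP <-]; [left|right].
- by exists a; rewrite !inE ag eqxx.
- by exists b; rewrite !inE bg eqxx orbT.
Qed.

Lemma card2_eq {V : finType} (g : {set V}) a b :
  #|g| = 2 -> a != b -> a \in g -> b \in g -> g = [set a; b].
Proof.
move=> cg ab ga gb; apply/esym/eqP.
by rewrite eqEcard cards2 ab cg subUset !sub1set ga gb.
Qed.

Lemma card2_other {V : finType} (g : {set V}) a :
  #|g| = 2 -> a \in g -> exists b, [/\ a != b, b \in g & g = [set a; b]].
Proof.
move=> cg ga; have := cardsD1 a g; rewrite cg ga => -[]/esym/eqP/cards1P[b gb].
have : b \in g :\ a by rewrite gb set11.
rewrite !inE eq_sym => /andP[ab bg]; exists b; split=> //; exact: card2_eq.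
Qed.

Definition cross_intersecting {V : finType} (G1 G2 : {set {set V}}) : Prop :=
  {in G1 & G2, forall g h, g :&: h != set0}.

(** The six shapes of a pair of links lead in order to [H0], ..., [H5]. In those below, [W] stands
    for the vertices off the cover, which keeps the special vertices distinct from the cover. *)
Definition cross_star {V : finType} (G1 G2 : {set {set V}}) : Prop :=
  exists x, {in G1, forall g : {set V}, x \in g} /\ {in G2, forall g : {set V}, x \in g}.

Definition cross_single {V : finType} (W : {set V}) (G1 G2 : {set {set V}}) : Prop :=
  exists a b, [/\ all (mem W) [:: a; b], uniq [:: a; b],
    G1 \subset [set [set a; b]]
    & {in G2, forall g : {set V}, (a \in g) || (b \in g)}].

Definition cross_cherry {V : finType} (W : {set V}) (G1 G2 : {set {set V}}) : Prop :=
  exists x a b, [/\ all (mem W) [:: x; a; b], uniq [:: x; a; b],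
    G1 \subset [set [set x; a]; [set x; b]]
    & {in G2, forall g : {set V}, (x \in g) || (g == [set a; b])}].

Definition cross_triangle {V : finType} (W : {set V}) (G1 G2 : {set {set V}}) : Prop :=
  exists a b c, [/\ all (mem W) [:: a; b; c], uniq [:: a; b; c],
    G1 \subset [set [set a; b]; [set a; c]; [set b; c]]
    & G2 \subset [set [set a; b]; [set a; c]; [set b; c]]].

Definition cross_square {V : finType} (W : {set V}) (G1 G2 : {set {set V}}) : Prop :=
  exists a a' b b', [/\ all (mem W) [:: a; a'; b; b'], uniq [:: a; a'; b; b'],
    G1 \subset [set [set a; a']; [set b; b']]
    & G2 \subset [set [set a; b]; [set a; b']; [set a'; b]; [set a'; b']]].

(** The full shape is a pair of three-edge paths, a'-a-b'-b and b-a-b'-a', with the same middle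
    edge. *)
Definition cross_paths {V : finType} (W : {set V}) (G1 G2 : {set {set V}}) : Prop :=
  exists a a' b b', [/\ all (mem W) [:: a; a'; b; b'], uniq [:: a; a'; b; b'],
    G1 \subset [set [set a; a']; [set b; b']; [set a; b']]
    & G2 \subset [set [set a; b']; [set a; b]; [set a'; b']]].

(** An intersecting graph is a star or a triangle. One edge gives [cross_single], two edges {x, a},
    {x, b} give [cross_cherry], and adding {a, b} gives [cross_triangle]. A third edge {x, c} is
    disjoint from {a, b}, the only possible edge of [G2] missing [x], so [cross_star] results. *)
Lemma cross_intersecting_left {V : finType} (W : {set V}) (G1 G2 : {set {set V}}) :
    r_graph 2 G1 -> r_graph 2 G2 -> {in G1, forall g : {set V}, g \subset W} ->
    G1 != set0 -> intersecting G1 -> cross_intersecting G1 G2 ->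
  cross_star G1 G2 \/ cross_single W G1 G2 \/ cross_cherry W G1 G2 \/
  cross_triangle W G1 G2.
Proof.
move=> G1_2 G2_2 GW /set0Pn[g0 Gg0] iG xG.
have [sub|/subsetPn[g1 Gg1]] := boolP (G1 \subset [set g0]).
  right; left; have /cards2P[a [b [ab g0E]]] : #|g0| == 2 by rewrite G1_2.
  exists a, b; split; rewrite /= -?g0E ?inE ?ab //.
    by rewrite !(subsetP (GW _ Gg0)) // g0E !inE eqxx ?orbT.
  by move=> g Gg; rewrite -meet_pairE setIC -g0E xG.
rewrite inE => g10; have /set0Pn[x /setIP[x0 x1]] := iG _ _ Gg0 Gg1.
have [a [xa ag g0E]] := @card2_other _ _ _ (G1_2 _ Gg0) x0.
have [b [xb bg g1E]] := @card2_other _ _ _ (G1_2 _ Gg1) x1.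
have ab : a != b by apply: contraNneq g10 => ab; rewrite g1E -ab -g0E.
have Wxab : all (mem W) [:: x; a; b].
  by rewrite /= !(subsetP (GW _ Gg0) _ x0, subsetP (GW _ Gg0) _ ag, subsetP (GW _ Gg1) _ bg).
have uxab : uniq [:: x; a; b] by rewrite /= !inE negb_or xa xb ab.
have meet0 g : g :&: g0 != set0 -> g :&: g1 != set0 -> (x \in g) || (a \in g) && (b \in g).
  by rewrite g0E g1E !meet_pairE; case: (x \in g) => //= -> ->.
have tri (G : {set {set V}}) : r_graph 2 G -> {in G, forall g, g :&: g0 != set0} ->
    {in G, forall g, g :&: g1 != set0} -> {in G, forall g, g :&: [set a; b] != set0} ->
    G \subset [set [set x; a]; [set x; b]; [set a; b]].
  move=> G_2 m0 m1 mab; apply/subsetP => g Gg; have := mab g Gg; rewrite meet_pairE !inE.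
  have cg := G_2 g Gg.
  case/orP: (@meet0 g (m0 g Gg) (m1 g Gg)) => [xg /orP[ga|gb]|/andP[ga gb] _].
  - by rewrite [g == [set x; a]](introT eqP _) //; apply: card2_eq.
  - by rewrite [g == [set x; b]](introT eqP _) ?orbT //; apply: card2_eq.
  - by rewrite [g == [set a; b]](introT eqP _) ?orbT //; apply: card2_eq.
have m2 g : g \in G2 -> g :&: g0 != set0 /\ g :&: g1 != set0.
  by move=> Gg; rewrite ![g :&: _]setIC !xG.
have [Gab|Gab] := boolP ([set a; b] \in G1).
  right; right; right; exists x, a, b; split=> //; apply: tri => // g Gg.
  - exact: iG.
  - exact: iG.
  - exact: iG.
  - by case: (m2 g Gg).
  - by case: (m2 g Gg).
  - by rewrite setIC xG.
have G1x g : g \in G1 -> x \in g.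
  move=> Gg; case/orP: (@meet0 g (iG _ _ Gg Gg0) (iG _ _ Gg Gg1)) => // /andP[ga gb].
  by case/negP: Gab; rewrite -(@card2_eq _ g a b) //; apply: G1_2.
have [sub|/subsetPn[g2 Gg2]] := boolP (G1 \subset [set [set x; a]; [set x; b]]).
  right; right; left; exists x, a, b; split=> // g Gg.
  have [h0 h1] := m2 g Gg; case/orP: (@meet0 g h0 h1) => [->//|/andP[ga gb]].
  by rewrite orbC [g == _](introT eqP _) //; apply: card2_eq => //; apply: G2_2.
rewrite !inE negb_or => /andP[g2a g2b].
have [c [xc cg g2E]] := @card2_other _ _ _ (G1_2 _ Gg2) (G1x _ Gg2).
left; exists x; split=> // g Gg; apply: contraT => xg.
have [h0 h1] := m2 g Gg; have := @meet0 g h0 h1; rewrite (negbTE xg) /= => /andP[ga gb].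
have := xG _ _ Gg2 Gg; rewrite setIC g2E meet_pairE (negbTE xg) /= => gc.
rewrite (@card2_eq _ g a b (G2_2 _ Gg) ab ga gb) !inE in gc.
by case/orP: gc => /eqP cE; [case/negP: g2a | case/negP: g2b]; rewrite g2E cE.
Qed.

Lemma card2_between {V : finType} (g : {set V}) a a' b b' :
    #|g| = 2 -> uniq [:: a; a'; b; b'] ->
    g :&: [set a; a'] != set0 -> g :&: [set b; b'] != set0 ->
  g \in [set [set a; b]; [set a; b']; [set a'; b]; [set a'; b']].
Proof.
move=> cg; rewrite !meet_pairE /= !inE !negb_or andbT.
move=> /and3P[/and3P[aa' ab ab'] /andP[a'b a'b'] bb'].
have eqg u v : u != v -> u \in g -> v \in g -> g == [set u; v].
  by move=> uv gu gv; apply/eqP; apply: card2_eq.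
by case/orP => h1 /orP[] h2; rewrite (eqg _ _ _ h1 h2) ?orbT.
Qed.

(** The disjoint edges are forced to be {a, a'}, {b, b'} in [G1] and {a, b}, {a', b'} in [G2]. Only
    {a, b'} and {a', b} remain undecided, and neither graph may contain one while the other graph
    contains the other. If one graph has neither, a square arises; otherwise both have exactly the
    same one, which gives [cross_paths]. *)
Lemma cross_intersecting_disjoint {V : finType} (W : {set V}) (G1 G2 : {set {set V}})
    (g g' f f' : {set V}) :
    r_graph 2 G1 -> r_graph 2 G2 -> {in G1, forall g : {set V}, g \subset W} ->
    cross_intersecting G1 G2 ->
    g \in G1 -> g' \in G1 -> f \in G2 -> f' \in G2 ->
    g :&: g' = set0 -> f :&: f' = set0 ->
  cross_square W G1 G2 \/ cross_square W G2 G1 \/ cross_paths W G1 G2.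
Proof.
move=> G1_2 G2_2 GW xG Gg Gg' Gf Gf' gg' ff'.
have /set0Pn[a /setIP[ag af]] := xG _ _ Gg Gf.
have /set0Pn[b /setIP[bg bf]] := xG _ _ Gg' Gf.
have [a' [aa' a'g gE]] := @card2_other _ _ _ (G1_2 _ Gg) ag.
have [b' [bb' b'g g'E]] := @card2_other _ _ _ (G1_2 _ Gg') bg.
have dis (A B : {set V}) u v : A :&: B = set0 -> u \in A -> v \in B -> u != v.
  by move=> AB uA vB; apply: contra_eqN AB => /eqP uv; apply/set0Pn; exists u; rewrite inE uA uv.
have u4 : uniq [:: a; a'; b; b'].
  by rewrite /= !inE !negb_or aa' bb' !(dis g g').
have W4 : all (mem W) [:: a; a'; b; b'].
  by rewrite /= !(subsetP (GW _ Gg) _ ag, subsetP (GW _ Gg) _ a'g, subsetP (GW _ Gg') _ bg, subsetP (GW _ Gg') _ b'g).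
have fE : f = [set a; b] by apply: card2_eq => //; [exact: G2_2 | exact: (dis g g')].
have nf' v : v \in f -> v \notin f' by move=> vf; apply/negP => vf'; have := dis f f' v v ff' vf vf'; rewrite eqxx.
have a'f' : a' \in f'.
  by have := xG _ _ Gg Gf'; rewrite setIC gE meet_pairE (negbTE (nf' a af)).
have b'f' : b' \in f'.
  by have := xG _ _ Gg' Gf'; rewrite setIC g'E meet_pairE (negbTE (nf' b bf)).
have f'E : f' = [set a'; b'] by apply: card2_eq => //; [exact: G2_2 | exact: (dis g g')].
have sub2 : G2 \subset [set [set a; b]; [set a; b']; [set a'; b]; [set a'; b']].
  apply/subsetP => h Gh; apply: card2_between => //; first exact: G2_2.
    by rewrite setIC -gE xG.
  by rewrite setIC -g'E xG.
have u4' : uniq [:: a; b; a'; b'].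
  by move: u4; rewrite /= !inE !negb_or (eq_sym b a') => /and4P[/and3P[-> -> ->] /andP[-> ->] -> _].
have sub1 : G1 \subset [set [set a; a']; [set a; b']; [set b; a']; [set b; b']].
  apply/subsetP => h Gh; apply: card2_between => //; first exact: G1_2.
    by rewrite -fE xG.
  by rewrite -f'E xG.
have drop (G : {set {set V}}) p q s u : G \subset [set p; q; s; u] -> q \notin G -> s \notin G ->
    G \subset [set p; u].
  move=> sG qG sG'; apply/subsetP => h Gh; have := subsetP sG h Gh; rewrite !inE.
  by case: eqP => //= _; case: eqP => [hq|_] /=; [rewrite -hq Gh in qG | case: eqP => [hs|//]; rewrite -hs Gh in sG'].
have dropq (G : {set {set V}}) p q s u : G \subset [set p; q; s; u] -> q \notin G ->
    G \subset [set p; u; s].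
  move=> sG qG; apply/subsetP => h Gh; have := subsetP sG h Gh; rewrite !inE.
  case: (h =P p) => //= _; case: (h =P q) => [hq|_] /=; first by rewrite -hq Gh in qG.
  by rewrite orbC.
have drops (G : {set {set V}}) p q s u : G \subset [set p; q; s; u] -> s \notin G ->
    G \subset [set p; u; q].
  move=> sG qG; apply/subsetP => h Gh; have := subsetP sG h Gh; rewrite !inE.
  case: (h =P p) => //= _; case: (h =P s) => [hq|_] /=; first by rewrite -hq Gh in qG.
  by rewrite orbF orbC.
have apart p q s u : uniq [:: p; q; s; u] -> [set p; q] \in G1 -> [set s; u] \in G2 -> false.
  rewrite /= !inE !negb_or andbT => /and3P[/and3P[pq ps pu] /andP[qs qu] su] Gp Gs.
  have := xG _ _ Gp Gs; rewrite meet_pairE !inE.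
  by rewrite (eq_sym s p) (negbTE ps) (eq_sym s q) (negbTE qs) (eq_sym u p) (negbTE pu) (eq_sym u q) (negbTE qu).
have u1 : uniq [:: b; a'; a; b'].
  move: u4; rewrite /= !inE !negb_or (eq_sym b a') (eq_sym b a) (eq_sym a' a).
  by move=> /and4P[/and3P[-> -> ->] /andP[-> ->] -> _].
have u2 : uniq [:: a; b'; a'; b].
  move: u4; rewrite /= !inE !negb_or (eq_sym b' a') (eq_sym b' b).
  by move=> /and4P[/and3P[-> -> ->] /andP[-> ->] -> _].
have [p2|p2] := boolP ([set a; b'] \in G2).
  have q1 : [set b; a'] \notin G1 by apply/negP => q1; have := apart _ _ _ _ u1 q1 p2.
  have [p1|p1] := boolP ([set a; b'] \in G1); last by left; exists a, a', b, b'; split=> //; apply: drop sub1 p1 q1.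
  have q2 : [set a'; b] \notin G2 by apply/negP => q2; have := apart _ _ _ _ u2 p1 q2.
  right; right; exists a, a', b, b'; split=> //; first exact: drops sub1 q1.
  apply: subset_trans (drops _ _ _ _ _ sub2 q2) _.
  by apply/subsetP => h; rewrite !inE => /orP[/orP[]|] ->; rewrite ?orbT.
have [q2|q2] := boolP ([set a'; b] \in G2); last first.
  by right; left; exists a, b, a', b'; split; rewrite ?(drop _ _ _ _ _ sub2) //=; move: W4 => /= /and4P[-> -> -> /andP[->]].
have p1 : [set a; b'] \notin G1 by apply/negP => p1; have := apart _ _ _ _ u2 p1 q2.
have [q1|q1] := boolP ([set b; a'] \in G1); last by left; exists a, a', b, b'; split=> //; apply: drop sub1 p1 q1.
(* The labels are swapped so that the common middle edge is {a', b}. *)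
right; right; exists a', a, b', b; split.
- by move: W4 => /= /and4P[-> -> -> /andP[->]].
- move: u4; rewrite /= !inE !negb_or (eq_sym b' b) (eq_sym a' a).
  by move=> /and4P[/and3P[-> -> ->] /andP[-> ->] -> _].
- have := dropq _ _ _ _ _ sub1 p1.
  by rewrite (setUC [set a']) (setUC [set b']) (setUC [set a'] [set b]).
- apply: subset_trans (dropq _ _ _ _ _ sub2 p2) _.
  by apply/subsetP => h; rewrite !inE => /orP[/orP[]|] ->; rewrite ?orbT.
Qed.

(** If one graph is intersecting, [cross_intersecting_left] applies, with the roles exchanged if
    necessary; otherwise each graph has two disjoint edges. *)
Lemma cross_intersecting_shape {V : finType} (W : {set V}) (G1 G2 : {set {set V}}) :
    r_graph 2 G1 -> r_graph 2 G2 ->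
    {in G1, forall g : {set V}, g \subset W} -> {in G2, forall g : {set V}, g \subset W} ->
    G1 != set0 -> G2 != set0 -> cross_intersecting G1 G2 ->
  cross_star G1 G2 \/ cross_single W G1 G2 \/ cross_single W G2 G1 \/
  cross_cherry W G1 G2 \/ cross_cherry W G2 G1 \/ cross_triangle W G1 G2 \/
  cross_square W G1 G2 \/ cross_square W G2 G1 \/ cross_paths W G1 G2.
Proof.
move=> G1_2 G2_2 W1 W2 n1 n2 x12.
have x21 : cross_intersecting G2 G1 by move=> g h Gg Gh; rewrite setIC x12.
have dec (G : {set {set V}}) : intersecting G \/
    exists g g', [/\ g \in G, g' \in G & g :&: g' = set0].
  have [/forall_inP iG|] := boolP [forall g in G, forall h in G, g :&: h != set0].
    by left=> g h Gg Gh; have /forall_inP := iG g Gg; apply.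
  rewrite negb_forall_in => /exists_inP[g Gg]; rewrite negb_forall_in => /exists_inP[h Gh].
  by rewrite negbK => /eqP gh; right; exists g, h.
have [i1|[g [g' [Gg Gg' gg']]]] := dec G1.
  have := @cross_intersecting_left _ W G1 G2 G1_2 G2_2 W1 n1 i1 x12; tauto.
have [i2|[f [f' [Gf Gf' ff']]]] := dec G2.
  have := @cross_intersecting_left _ W G2 G1 G2_2 G1_2 W2 n2 i2 x21.
  case=> [[x [h2 h1]]|[|[|[a [b [c [hW hu h2 h1]]]]]]]; try tauto.
    by left; exists x.
  by do 5![right]; left; exists a, b, c.
have := @cross_intersecting_disjoint _ W G1 G2 g g' f f' G1_2 G2_2 W1 x12 Gg Gg' Gf Gf' gg' ff'.
tauto.
Qed.

(** * Intersecting 3-graphs with a cover of size two *)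

(** Edges through both [v] and [w] are left out: each of [H0], ..., [H5] contains all triples over
    its cover pair. *)
Definition link {V : finType} (T : {set {set V}}) (v w : V) :=
  [set g : {set V} | [&& v \notin g, w \notin g & v |: g \in T]].

Lemma link_card {V : finType} (T : {set {set V}}) v w :
  r_graph 3 T -> r_graph 2 (link T v w).
Proof.
move=> T3 g; rewrite inE => /and3P[vg _ /T3]; by rewrite cardsU1 vg => -[].
Qed.

Lemma link_sub {V : finType} (T : {set {set V}}) v w :
  {in link T v w, forall g : {set V}, g \subset ~: [set v; w]}.
Proof.
move=> g; rewrite inE => /and3P[vg wg _]; apply/subsetP => u ug.
by rewrite !inE negb_or; apply/andP; split; [apply: contraNneq vg | apply: contraNneq wg] => <-.
Qed.

Lemma link_cross {V : finType} (T : {set {set V}}) v w :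
  v != w -> intersecting T -> cross_intersecting (link T v w) (link T w v).
Proof.
move=> vw iT g h; rewrite !inE => /and3P[vg wg Tg] /and3P[wh vh Th].
have /set0Pn[u] := iT _ _ Tg Th; rewrite !inE => /andP[/orP[/eqP->|ug]].
  by rewrite (negbTE vw) (negbTE vh).
case/orP => [/eqP uw|uh]; first by rewrite -uw ug in wg.
by apply/set0Pn; exists u; rewrite inE ug.
Qed.

Lemma link_cases {V : finType} (T : {set {set V}}) v w t :
    t \in T -> (v \in t) || (w \in t) ->
  [\/ v \in t /\ w \in t,
      exists2 g, g \in link T v w & t = v |: g
    | exists2 g, g \in link T w v & t = w |: g].
Proof.
move=> Tt; have [vt|vt] := boolP (v \in t); have [wt|wt] //= := boolP (w \in t) => _.
- by constructor 1.
- constructor 2; exists (t :\ v); last by rewrite setD1K.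
  by rewrite !inE eqxx /= setD1K // Tt (negbTE wt) andbF.
- constructor 3; exists (t :\ w); last by rewrite setD1K.
  by rewrite !inE eqxx /= setD1K // Tt (negbTE vt) andbF.
Qed.

Lemma triples_overP {V : finType} (t : {set V}) u v :
  #|t| = 3 -> u \in t -> v \in t -> t \in triples_over [set u; v].
Proof. by move=> ct ut vt; rewrite inE ct eqxx subUset !sub1set ut vt. Qed.

(** The common vertex [x] of the links joins [v1], [v2] as third special vertex. It differs from
    both because it lies in an edge of the nonempty link. *)
Lemma sub_H0 {V : finType} (T : {set {set V}}) v1 v2 : v1 != v2 ->
    r_graph 3 T -> (forall t, t \in T -> (v1 \in t) || (v2 \in t)) ->
    link T v1 v2 != set0 -> cross_star (link T v1 v2) (link T v2 v1) ->
  exists x x1 x2, uniq [:: x; x1; x2] /\ T \subset H0 x x1 x2.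
Proof.
move=> v12 T3 cT /set0Pn[g Gg] [x [x1 x2]].
have := subsetP (link_sub _ _ _ _ Gg) x (x1 _ Gg).
rewrite !inE negb_or => /andP[xv1 xv2].
exists v1, v2, x; rewrite /= !inE negb_or v12 eq_sym xv1 eq_sym xv2; split=> //.
have two (t : {set V}) u w : u != w -> u \in t -> w \in t ->
    [set u; w] \subset [set v1; v2; x] -> 2 <= #|t :&: [set v1; v2; x]|.
  move=> uw ut wt sub; have <- : #|[set u; w]| = 2 by rewrite cards2 uw.
  by apply: subset_leq_card; rewrite subsetI sub subUset !sub1set ut wt.
apply/subsetP => t Tt; rewrite inE T3 // eqxx /=.
case: (@link_cases _ T v1 v2 t Tt (cT t Tt)) => [[t1 t2]|[h Gh ->]|[h Gh ->]].
- by apply: (two t v1 v2) => //; rewrite subUset !sub1set !inE !eqxx ?orbT.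
- apply: (two _ v1 x); rewrite ?inE ?eqxx ?x1 ?orbT // 1?eq_sym //.
  by rewrite subUset !sub1set !inE !eqxx ?orbT.
- apply: (two _ v2 x); rewrite ?inE ?eqxx ?x2 ?orbT // 1?eq_sym //.
  by rewrite subUset !sub1set !inE !eqxx ?orbT.
Qed.

(** [v2] is the centre: every edge contains it together with [v1], [a] or [b], except possibly {v1,
    a, b}. *)
Lemma sub_H1 {V : finType} (T : {set {set V}}) v1 v2 : v1 != v2 ->
    r_graph 3 T -> (forall t, t \in T -> (v1 \in t) || (v2 \in t)) ->
    cross_single (~: [set v1; v2]) (link T v1 v2) (link T v2 v1) ->
  exists x x1 x2 y1, uniq [:: x; x1; x2; y1] /\ T \subset H1 x x1 x2 y1.
Proof.
move=> v12 T3 cT [a [b [W u G1 G2]]]; exists v2, v1, a, b; split.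
  move: W u; rewrite /= !inE !negb_or (eq_sym v2 v1) v12 (eq_sym v1 a) (eq_sym v2 a).
  by rewrite (eq_sym v1 b) (eq_sym v2 b) => /and3P[/andP[-> ->] /andP[-> ->] _] ->.
apply/subsetP => t Tt; have ct := T3 t Tt; rewrite !in_setU.
case: (@link_cases _ T v1 v2 t Tt (cT t Tt)) => [[t1 t2]|[h Gh tE]|[h Gh tE]].
- by rewrite (@triples_overP _ t v2 v1).
- have := subsetP G1 h Gh; rewrite inE => /eqP hE.
  by rewrite in_set1 tE hE setUA eqxx ?orbT.
- have tv : v2 \in t by rewrite tE !inE eqxx.
  case/orP: (G2 h Gh) => hv.
    by rewrite (@triples_overP _ t v2 a) ?orbT // tE inE hv orbT.
  by rewrite (@triples_overP _ t v2 b) ?orbT // tE inE hv orbT.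
Qed.

(** [v2] is the centre, paired with [v1] and [x]. The cherry supplies {v1, x, a} and {v1, x, b}, and
    the edge {a, b} of the other link supplies {v2, a, b}. *)
Lemma sub_H2 {V : finType} (T : {set {set V}}) v1 v2 : v1 != v2 ->
    r_graph 3 T -> (forall t, t \in T -> (v1 \in t) || (v2 \in t)) ->
    cross_cherry (~: [set v1; v2]) (link T v1 v2) (link T v2 v1) ->
  exists x x1 x2 y1 y2, uniq [:: x; x1; x2; y1; y2] /\ T \subset H2 x x1 x2 y1 y2.
Proof.
move=> v12 T3 cT [x [a [b [W u G1 G2]]]]; exists v2, v1, x, a, b; split.
  move: W u; rewrite /= !inE !negb_or (eq_sym v2 v1) v12 (eq_sym v1 a) (eq_sym v2 a).
  rewrite (eq_sym v1 b) (eq_sym v2 b) (eq_sym v1 x) (eq_sym v2 x).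
  by move=> /and4P[/andP[-> ->] /andP[-> ->] /andP[-> ->] _] ->.
apply/subsetP => t Tt; have ct := T3 t Tt; rewrite !in_setU !in_set1.
case: (@link_cases _ T v1 v2 t Tt (cT t Tt)) => [[t1 t2]|[h Gh tE]|[h Gh tE]].
- by rewrite (@triples_overP _ t v2 v1).
- have := subsetP G1 h Gh; rewrite !inE => /orP[] /eqP hE;
  by rewrite tE hE setUA eqxx ?orbT.
- have tv : v2 \in t by rewrite tE !inE eqxx.
  case/orP: (G2 h Gh) => [hx|/eqP hE].
    by rewrite (@triples_overP _ t v2 x) ?orbT // tE inE hx orbT.
  by rewrite tE hE setUA eqxx ?orbT.
Qed.

Lemma sub_H3 {V : finType} (T : {set {set V}}) v1 v2 : v1 != v2 ->
    r_graph 3 T -> (forall t, t \in T -> (v1 \in t) || (v2 \in t)) ->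
    cross_triangle (~: [set v1; v2]) (link T v1 v2) (link T v2 v1) ->
  exists v1 v2 y1 y2 y3, uniq [:: v1; v2; y1; y2; y3] /\ T \subset H3 v1 v2 y1 y2 y3.
Proof.
move=> v12 T3 cT [a [b [c [W u G1 G2]]]]; exists v1, v2, a, b, c; split.
  move: W u; rewrite /= !inE !negb_or v12 (eq_sym v1 a) (eq_sym v2 a).
  rewrite (eq_sym v1 b) (eq_sym v2 b) (eq_sym v1 c) (eq_sym v2 c).
  by move=> /and4P[/andP[-> ->] /andP[-> ->] /andP[-> ->] _] ->.
apply/subsetP => t Tt; have ct := T3 t Tt; rewrite !in_setU !in_set1.
case: (@link_cases _ T v1 v2 t Tt (cT t Tt)) => [[t1 t2]|[h Gh tE]|[h Gh tE]].
- by rewrite (@triples_overP _ t v1 v2).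
- have := subsetP G1 h Gh; rewrite !inE => /orP[/orP[]|] /eqP hE;
  by rewrite tE hE setUA eqxx ?orbT.
- have := subsetP G2 h Gh; rewrite !inE => /orP[/orP[]|] /eqP hE;
  by rewrite tE hE setUA eqxx ?orbT.
Qed.

Lemma uniq_outside {V : finType} (v1 v2 a a' b b' : V) : v1 != v2 ->
    all (mem (~: [set v1; v2])) [:: a; a'; b; b'] -> uniq [:: a; a'; b; b'] ->
  uniq [:: v1; v2; a; a'; b; b'].
Proof.
move=> v12 /allP W u; rewrite cons_uniq [uniq (v2 :: _)]cons_uniq u andbT inE negb_or v12 /=.
have out v : v \in [set v1; v2] -> v \notin [:: a; a'; b; b'].
  by move=> vin; apply/negP => /W; rewrite inE /= inE vin.
by rewrite !out // !inE eqxx ?orbT.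
Qed.

Lemma sub_H4 {V : finType} (T : {set {set V}}) v1 v2 : v1 != v2 ->
    r_graph 3 T -> (forall t, t \in T -> (v1 \in t) || (v2 \in t)) ->
    cross_square (~: [set v1; v2]) (link T v1 v2) (link T v2 v1) ->
  exists v1 v2 a a' b b', uniq [:: v1; v2; a; a'; b; b'] /\ T \subset H4 v1 v2 a a' b b'.
Proof.
move=> v12 T3 cT [a [a' [b [b' [W u G1 G2]]]]]; exists v1, v2, a, a', b, b'.
split; first exact: uniq_outside.
apply/subsetP => t Tt; have ct := T3 t Tt; rewrite !in_setU !in_set1.
case: (@link_cases _ T v1 v2 t Tt (cT t Tt)) => [[t1 t2]|[h Gh tE]|[h Gh tE]].
- by rewrite (@triples_overP _ t v1 v2).
- have := subsetP G1 h Gh; rewrite !inE => /orP[] /eqP hE;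
  by rewrite tE hE setUA eqxx ?orbT.
- have := subsetP G2 h Gh; rewrite !inE => /orP[/orP[/orP[]|]|] /eqP hE;
  by rewrite tE hE setUA eqxx ?orbT.
Qed.

Lemma sub_H5 {V : finType} (T : {set {set V}}) v1 v2 : v1 != v2 ->
    r_graph 3 T -> (forall t, t \in T -> (v1 \in t) || (v2 \in t)) ->
    cross_paths (~: [set v1; v2]) (link T v1 v2) (link T v2 v1) ->
  exists v1 v2 a a' b b', uniq [:: v1; v2; a; a'; b; b'] /\ T \subset H5 v1 v2 a a' b b'.
Proof.
move=> v12 T3 cT [a [a' [b [b' [W u G1 G2]]]]]; exists v1, v2, a, a', b, b'.
split; first exact: uniq_outside.
apply/subsetP => t Tt; have ct := T3 t Tt; rewrite !in_setU !in_set1.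
case: (@link_cases _ T v1 v2 t Tt (cT t Tt)) => [[t1 t2]|[h Gh tE]|[h Gh tE]].
- by rewrite (@triples_overP _ t v1 v2).
- have := subsetP G1 h Gh; rewrite !inE => /orP[/orP[]|] /eqP hE;
  by rewrite tE hE setUA eqxx ?orbT.
- have := subsetP G2 h Gh; rewrite !inE => /orP[/orP[]|] /eqP hE;
  by rewrite tE hE setUA eqxx ?orbT.
Qed.

Lemma superedges_trans {V : finType} r (H T K : {set {set V}}) :
  H \subset superedges r T -> T \subset K -> H \subset superedges r K.
Proof.
move=> HT TK; apply: subset_trans HT _; apply/subsetP => e; rewrite !inE.
case/andP => -> /exists_inP[t Tt te]; apply/exists_inP; exists t => //.
exact: (subsetP TK).
Qed.

Lemma contained_EM_superedges {V : finType} r (H T : {set {set V}}) x :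
  H \subset superedges r T -> {in T, forall t : {set V}, x \in t} -> contained_EM r H.
Proof.
move=> HT Tx; exists x; apply: subset_trans HT _; apply/subsetP => e; rewrite !inE.
by case/andP => -> /exists_inP[t /Tx xt te]; rewrite (subsetP te).
Qed.

(** If one link is empty, the other cover vertex lies in every triple and the star results.
    Otherwise the shape of the two links decides, with the cover vertices exchanged for the
    asymmetric shapes. *)
Lemma two_cover_contained {V : finType} r (H T : {set {set V}}) v1 v2 :
    H \subset superedges r T -> r_graph 3 T -> intersecting T -> v1 != v2 ->
    (forall t, t \in T -> (v1 \in t) || (v2 \in t)) ->
  contained_H0 r H \/ contained_H1 r H \/ contained_H2 r H \/ contained_H3 r H \/
  contained_H4 r H \/ contained_H5 r H \/ contained_EM r H.
Proof.
move=> HT T3 iT v12 cT; have v21 : v2 != v1 by rewrite eq_sym.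
have cT' t : t \in T -> (v2 \in t) || (v1 \in t) by rewrite orbC; apply: cT.
have [l1|n1] := eqVneq (link T v1 v2) set0.
  do 6!right; apply: (@contained_EM_superedges _ _ _ _ v2 HT) => t Tt.
  case: (@link_cases _ T v1 v2 t Tt (cT t Tt)) => [[//]|[h]|[h _ ->]].
    by rewrite l1 inE.
  by rewrite !inE eqxx.
have [l2|n2] := eqVneq (link T v2 v1) set0.
  do 6!right; apply: (@contained_EM_superedges _ _ _ _ v1 HT) => t Tt.
  case: (@link_cases _ T v1 v2 t Tt (cT t Tt)) => [[//]|[h _ ->]|[h]].
    by rewrite !inE eqxx.
  by rewrite l2 inE.
have W2 : {in link T v2 v1, forall g : {set V}, g \subset ~: [set v1; v2]}.
  by rewrite setUC; apply: link_sub.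
have CW : ~: [set v1; v2] = ~: [set v2; v1] by rewrite setUC.
have shape := @cross_intersecting_shape _ _ _ _ (@link_card _ T v1 v2 T3)
  (@link_card _ T v2 v1 T3) (@link_sub _ T v1 v2) W2 n1 n2 (@link_cross _ T v1 v2 v12 iT).
have up := @superedges_trans _ r H T _ HT.
case: shape => [s|[s|[s|[s|[s|[s|[s|[s|s]]]]]]]].
- have [x [x1 [x2 [u sT]]]] := @sub_H0 _ T v1 v2 v12 T3 cT n1 s.
  by left; exists x, x1, x2; split=> //; apply: up.
- have [x [x1 [x2 [y1 [u sT]]]]] := @sub_H1 _ T v1 v2 v12 T3 cT s.
  by right; left; exists x, x1, x2, y1; split=> //; apply: up.
- rewrite CW in s; have [x [x1 [x2 [y1 [u sT]]]]] := @sub_H1 _ T v2 v1 v21 T3 cT' s.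
  by right; left; exists x, x1, x2, y1; split=> //; apply: up.
- have [x [x1 [x2 [y1 [y2 [u sT]]]]]] := @sub_H2 _ T v1 v2 v12 T3 cT s.
  by do 2!right; left; exists x, x1, x2, y1, y2; split=> //; apply: up.
- rewrite CW in s; have [x [x1 [x2 [y1 [y2 [u sT]]]]]] := @sub_H2 _ T v2 v1 v21 T3 cT' s.
  by do 2!right; left; exists x, x1, x2, y1, y2; split=> //; apply: up.
- have [x [x1 [x2 [y1 [y2 [u sT]]]]]] := @sub_H3 _ T v1 v2 v12 T3 cT s.
  by do 3!right; left; exists x, x1, x2, y1, y2; split=> //; apply: up.
- have [x [x1 [x2 [y1 [y2 [z [u sT]]]]]]] := @sub_H4 _ T v1 v2 v12 T3 cT s.
  by do 4!right; left; exists x, x1, x2, y1, y2, z; split=> //; apply: up.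
- rewrite CW in s; have [x [x1 [x2 [y1 [y2 [z [u sT]]]]]]] := @sub_H4 _ T v2 v1 v21 T3 cT' s.
  by do 4!right; left; exists x, x1, x2, y1, y2, z; split=> //; apply: up.
- have [x [x1 [x2 [y1 [y2 [z [u sT]]]]]]] := @sub_H5 _ T v1 v2 v12 T3 cT s.
  by do 5!right; left; exists x, x1, x2, y1, y2, z; split=> //; apply: up.
Qed.

(** * Edge counts *)

Lemma leq_card_superedges {V : finType} r (T : {set {set V}}) :
  r_graph 3 T -> #|superedges r T| <= #|T| * 'C(#|V|, r - 3).
Proof.
move=> T3; rewrite -sum_nat_const.
apply: (@leq_trans (\sum_(t in T) #|[set e : {set V} | (#|e| == r) && (t \subset e)]|)).
  apply: leq_trans (leq_card_bigcup _ _); apply/subset_leq_card/subsetP => e.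
  rewrite inE => /andP[ce /exists_inP[t Tt te]].
  by apply/bigcupP; exists t; rewrite // inE ce.
by apply: leq_sum => t Tt; rewrite -(T3 t Tt) card_supersets_leq.
Qed.

(** Joining a triple in [X] with r-3 vertices outside [X] is injective, since the two parts are the
    traces of the union on [X] and on its complement. *)
Lemma geq_card_superedges {V : finType} r (G T : {set {set V}}) (X : {set V}) :
    3 <= r -> r_graph 3 T -> {in T, forall t : {set V}, t \subset X} ->
    {in T, forall t : {set V}, exists2 A, A \in G & A \subset t} ->
  #|T| * 'C(#|V| - #|X|, r - 3) <= #|superedges r G|.
Proof.
move=> hr T3 TX TG; have <- : #|~: X| = #|V| - #|X| by have := cardsC X; lia.
rewrite -cards_draws -cardsX.
rewrite -(card_in_imset (f := fun p : {set V} * {set V} => p.1 :|: p.2)); last first.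
  move=> [t s] [t' s']; rewrite !inE /= => /andP[Tt /andP[sX _]] /andP[Tt' /andP[sX' _]] eqU.
  have trace (a b : {set V}) : a \subset X -> b \subset ~: X ->
      (a :|: b) :&: X = a /\ (a :|: b) :\: X = b.
    move=> aX bX; have bX0 : [disjoint b & X] by rewrite -(setCK X) -subsets_disjoint.
    split; first by rewrite setIUl (setIidPl aX) (disjoint_setI0 bX0) setU0.
    by rewrite setDUl (setDidPl bX0) (eqP (_ : a :\: X == set0)) ?set0U // setD_eq0.
  have [t1 s1] := trace _ _ (TX _ Tt) sX; have [t2 s2] := trace _ _ (TX _ Tt') sX'.
  by congr pair; [rewrite -t1 eqU | rewrite -s1 eqU].
apply/subset_leq_card/subsetP => _ /imsetP[[t s] + ->].
rewrite !inE /= => /andP[Tt /andP[sX /eqP cs]].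
have [A GA At] := TG t Tt; apply/andP; split; last first.
  by apply/exists_inP; exists A; rewrite // (subset_trans At) // subsetUl.
have ts : [disjoint t & s].
  by rewrite disjoint_sym disjoints_subset (subset_trans sX) // setCS TX.
by rewrite cardsU (disjoint_setI0 ts) cards0 (T3 t Tt) cs; apply/eqP; lia.
Qed.

(** The r(r-1) triples {x, y, z} and the triple {x, y1, y2} are generators inside X; their number is
    exactly 13 at r = 4. *)
Lemma card_FP_geq {V : finType} r (FP : {set {set V}}) :
  4 <= r -> is_FP r FP -> 13 * 'C(#|V| - 2 * r, r - 3) <= #|FP|.
Proof.
move=> hr [x [Y [Z [y1 [y2 [cX cY cZ [Yy1 Yy2 y12] ->]]]]]].
have [xYZ YZ0] : x \notin Y :|: Z /\ Y :&: Z = set0.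
  have := cX; rewrite cardsU1 cardsU cY cZ => eqc.
  have le : #|Y :&: Z| <= r by rewrite -cY subset_leq_card // subsetIl.
  have : x \notin Y :|: Z /\ #|Y :&: Z| = 0 by case: (x \in _) eqc => /=; lia.
  by case=> -> /eqP; rewrite cards_eq0 => /eqP.
have [xY xZ] : x \notin Y /\ x \notin Z by move: xYZ; rewrite inE negb_or => /andP.
have notZ v : v \in Y -> v \notin Z.
  by move=> Yv; apply/negP => Zv; have := in_set0 v; rewrite -YZ0 inE Yv Zv.
have nx v : v \in Y -> x != v by apply: contraTneq => <-.
have nz v : v \in Z -> x != v by apply: contraTneq => <-.
have nyz v w : v \in Y -> w \in Z -> v != w.
  by move=> Yv Zw; apply: contraTneq Zw => <-; apply: notZ.
pose T1 := [set [set x; p.1; p.2] | p in setX Y Z].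
pose T := [set x; y1; y2] |: T1.
have cT1 : #|T1| = r * r.-1.
  rewrite card_in_imset ?cardsX ?cY ?cZ // => -[y z] [y' z'] /=.
  rewrite !inE /= => /andP[Yy Zz] /andP[Yy' Zz'] eqT.
  have : y \in [set x; y'; z'] by rewrite -eqT !inE eqxx orbT.
  have : z \in [set x; y'; z'] by rewrite -eqT !inE eqxx orbT.
  rewrite !inE ![_ == x]eq_sym (negbTE (nx _ Yy)) (negbTE (nz _ Zz)) /=.
  rewrite (negbTE (nyz _ _ Yy Zz')) [z == y']eq_sym (negbTE (nyz _ _ Yy' Zz)) orbF /=.
  by move=> /eqP-> /eqP->.
have T1y : [set x; y1; y2] \notin T1.
  apply/imsetP => -[[y z]]; rewrite inE /= => /andP[Yy Zz] eqT.
  have : z \in [set x; y1; y2] by rewrite eqT !inE eqxx !orbT.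
  rewrite !inE eq_sym (negbTE (nz _ Zz)) ![z == _]eq_sym.
  by rewrite (negbTE (nyz _ _ Yy1 Zz)) (negbTE (nyz _ _ Yy2 Zz)).
have card3 a b c : a != b -> a != c -> b != c -> #|[set a; b; c]| = 3.
  by move=> ab ac bc; rewrite setUC cardsU1 cards2 ab !inE negb_or eq_sym ac eq_sym bc.
have T3 : r_graph 3 T.
  move=> t; rewrite !inE => /orP[/eqP->|/imsetP[[y z]]].
    by apply: card3 => //; apply: nx.
  by rewrite inE /= => /andP[Yy Zz] ->; apply: card3; [apply: nx | apply: nz | apply: nyz].
apply: (@leq_trans (#|T| * 'C(#|V| - 2 * r, r - 3))).
  by rewrite leq_mul2r cardsU1 T1y cT1; apply/orP; right; nia.
rewrite -cX; apply: geq_card_superedges => //; first exact: ltnW.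
  move=> t; rewrite !inE => /orP[/eqP->|/imsetP[[y z]]].
    by rewrite !subUset !sub1set !inE eqxx Yy1 Yy2 !orbT.
  by rewrite inE /= => /andP[Yy Zz] ->; rewrite !subUset !sub1set !inE eqxx Yy Zz !orbT.
move=> t Tt; exists t => //; have ct := T3 t Tt; move: Tt.
rewrite !inE => /orP[/eqP->|/imsetP[[y z]]]; first by rewrite -!setUA eqxx ?orbT.
rewrite inE /= => /andP[Yy Zz] tE; apply/orP; left.
rewrite ct eqxx tE !subUset !sub1set !inE !eqxx Yy Zz !orbT /=.
by apply/andP; split; apply/set0Pn; [exists y | exists z]; rewrite !inE eqxx ?Yy ?Zz !orbT.
Qed.

(** * Deletion of the kernel-free edges and comparison with FP *)

Theorem theorem8 (r : nat) (hr : 4 <= r) :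
  exists C n0 : nat, 0 < C /\
    forall (n : nat) (V : finType) (H FP : {set {set V}}),
      n0 <= n -> #|V| = n ->
      r_graph r H -> intersecting H ->
      is_FP r FP -> #|FP| < #|H| ->
      exists D : {set {set V}},
        [/\ D \subset H, #|D| <= C * n ^ (r - 4)
          & contained_H0 r (H :\: D) \/ contained_H1 r (H :\: D) \/
            contained_H2 r (H :\: D) \/ contained_H3 r (H :\: D) \/
            contained_H4 r (H :\: D) \/ contained_H5 r (H :\: D) \/
            contained_EM r (H :\: D)].
Proof.
(* [r ^ 4] is the constant of [card_kernel_free]; the successor turns [n0 <= n] into the strict
   threshold of [binomial_gap]. *)
exists (r ^ 4), (39 * r * r + r`! * r ^ 4).+1; split; first by rewrite expn_gt0; lia.
move=> n V H FP hn cV rH iH fFP ltFP.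
have leD := @card_kernel_free V r H rH hr.
have sub := @kernel_free_complement V r H rH hr.
have T3 := @kernel_triples_card V r H.
have iT := @kernel_triples_intersecting V r H rH iH hr.
set D := kernel_free r H in leD sub *; set T := kernel_triples r H in sub T3 iT.
rewrite cV in leD; exists D; split=> //.
  by apply/subsetP => e; rewrite inE => /andP[].
have [/existsP[u /existsP[v /forall_inP cT]]|] :=
    boolP [exists u, exists v, forall t in T, (u \in t) || (v \in t)].
  have [uv|uv] := eqVneq u v; last exact: (@two_cover_contained _ _ _ T u v).
  do 6!right; apply: (@contained_EM_superedges _ _ _ T v) => // t Tt.
  by have := cT t Tt; rewrite uv orbb.
move=> /existsPn nT; have {}nT : no_2cover T.
  move=> u v; have := nT u; rewrite negb_exists => /forallP/(_ v).
  rewrite negb_forall_in => /exists_inP[t Tt]; rewrite negb_or => uv.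
  by exists t.
have leT := @card_no_2cover _ T T3 iT nT.
have leH : #|H :\: D| <= 12 * 'C(n, r - 3).
  apply: leq_trans (subset_leq_card sub) _; rewrite -cV.
  by apply: leq_trans (@leq_card_superedges _ r T T3) _; rewrite leq_mul2r leT orbT.
have gap := @binomial_gap r n hr hn.
have leFP := @card_FP_geq V r FP hr fFP; rewrite cV in leFP.
have cH : #|H| <= #|D| + #|H :\: D|.
  by rewrite -(cardsID D H) leq_add2r subset_leq_card // subsetIr.
(* Without a cover of size two, |H| <= |D| + 12 C(n, r-3) < 13 C(n-2r, r-3) <= |FP| < |H|, a
   contradiction. *)
have := leq_ltn_trans (leq_trans cH (leq_add leD leH)); rewrite addnC => /(_ _ gap) ltH.
by have := ltn_trans (leq_trans ltH leFP) ltFP; rewrite ltnn.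
Qed.
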